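(* Let $D$ be a group, let $(f,g)$ be a compatible averaging pair on $D$, and let $(D,\vdash,\dashv)$ be the $g$-digroup given by $a\vdash b=f(a)\,b$ and $a\dashv b=a\,g(b)$. Let $h$ be a left averaging operator on $D$ and define a further binary operation $\circ$ on $D$ by $a\circ b:=h(a)\,b$ for all $a,b\in D$. Then $(D,\vdash,\dashv,\circ)$ is a di-skew brace if and only if the following identities hold for all $a,b\in D$: $$h(a)f(b)=f(h(a)b)\,f(a)^{-1}\,h(a),$$ $$g(a)g(b)=g(h(a)b),$$ $$h(f(a)b)=h(a\,g(b)).$$
   Context: A left averaging operator on a group $D$ is a map $h:D\to D$ with $h(x)h(y)=h(h(x)y)$ for all $x,y\in D$. For a map $f:D\to D$ put $\ker(f)=\{x\in D\mid f(x)=1\}$. An averaging pair on $D$ is a pair of maps $f,g:D\to D$ such that $f(a)f(b)=f(f(a)b)=f(a\,g(b))$ and $g(a)g(b)=g(a\,g(b))=g(f(a)b)$ for all $a,b$; it is compatible if $\ker(f)\cap\ker(g)\neq\emptyset$. Exponents $-1$ on elements $f(a)$ denote inverses in the group $D$. A disemigroup is a set $D$ with two associative binary operations $\vdash,\dashv$ such that $a\vdash(b\dashv c)=(a\vdash b)\dashv c$, $a\dashv(b\vdash c)=a\dashv(b\dashv c)$ and $(a\vdash b)\vdash c=(a\dashv b)\vdash c$. A bar-unit is an element $e$ with $e\vdash a=a=a\dashv e$ for all $a$. A $g$-digroup is a disemigroup with at least one bar-unit such that for every $a$ and every bar-unit $e$ there is a unique pair $a^{I_e},a^{J_e}\in D$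 with $a^{I_e}\dashv a=e=a\vdash a^{J_e}$. In a $g$-digroup, $a^{I_e}\vdash b=a^{J_{e'}}\vdash b$ and $b\dashv a^{I_e}=b\dashv a^{J_{e'}}$ do not depend on the bar-units $e,e'$, and are written $a^{-1}\vdash b$, $b\dashv a^{-1}$. A right group is a semigroup in which every equation $a\circ x=b$ has a unique solution $x$. A di-skew brace is a quadruple $(D,\vdash,\dashv,\circ)$ where $(D,\vdash,\dashv)$ is a $g$-digroup, $(D,\circ)$ is a right group, and for all $a,b,c$ (with $\circ$ having higher precedence): $a\circ(b\vdash c)=a\circ b\vdash a^{-1}\vdash a\circ c$, $\ a\circ(b\dashv c)=a\circ b\dashv a^{-1}\dashv a\circ c$, $\ (a\vdash b)\circ c=(a\dashv b)\circ c$ (in these identities $a^{-1}$ is the digroup inverse). *)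

(* Defs.v *)
From mathcomp Require Import all_boot.

Set Implicit Arguments.
Unset Strict Implicit.
Unset Printing Implicit Defensive.

Local Open Scope group_scope.

Section AveragingMaps.
Variable D : groupType.
Implicit Types (f g h : D -> D).

Definition left_averaging_operator h : Prop :=
  forall x y, h x * h y = h (h x * y).

Definition kernel f (x : D) : Prop := f x = 1.

Record averaging_pair f g : Prop := {
  averaging_pair_fl : forall a b, f a * f b = f (f a * b);
  averaging_pair_fr : forall a b, f (f a * b) = f (a * g b);
  averaging_pair_gr : forall a b, g a * g b = g (a * g b);
  averaging_pair_gl : forall a b, g (a * g b) = g (f a * b)
}.

Definition compatible f g : Prop := exists x, kernel f x /\ kernel g x.

End AveragingMaps.

Section DiSkewBraces.
Variables (D : Type) (vdash dashv circ : D -> D -> D).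

Local Notation "a ⊢ b" := (vdash a b) (at level 40, left associativity).
Local Notation "a ⊣ b" := (dashv a b) (at level 40, left associativity).
Local Notation "a ∘ b" := (circ a b) (at level 39, left associativity).

Record disemigroup : Prop := {
  vdashA : associative vdash;
  dashvA : associative dashv;
  vdash_dashvA : forall a b c, a ⊢ (b ⊣ c) = (a ⊢ b) ⊣ c;
  dashv_vdashr : forall a b c, a ⊣ (b ⊢ c) = a ⊣ (b ⊣ c);
  vdash_dashvl : forall a b c, (a ⊢ b) ⊢ c = (a ⊣ b) ⊢ c
}.

Definition bar_unit (e : D) : Prop := forall a, e ⊢ a = a /\ a = a ⊣ e.

(* [p] is the pair (a^{I_e}, a^{J_e}) *)
Definition inverse_pair (e a : D) (p : D * D) : Prop :=
  p.1 ⊣ a = e /\ e = a ⊢ p.2.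

Record g_digroup : Prop := {
  g_digroup_disemigroup : disemigroup;
  g_digroup_bar_unit : exists e, bar_unit e;
  g_digroup_inverse : forall a e, bar_unit e -> exists! p, inverse_pair e a p
}.

(* [x] is one of the elements a^{I_e}, a^{J_e}, for some bar-unit e. In a
   g-digroup such an x exists, and neither x ⊢ b nor b ⊣ x depends on its
   choice (see the three lemmas below): these are the elements written
   a^{-1} ⊢ b and b ⊣ a^{-1}. *)
Definition digroup_inverse (a x : D) : Prop :=
  exists e p, [/\ bar_unit e, inverse_pair e a p & x = p.1 \/ x = p.2].

Lemma digroup_inverse_exists :
  g_digroup -> forall a, exists x, digroup_inverse a x.
Proof.
move=> [_ [e ue] inv] a; have [p [ip _]] := inv a e ue.
by exists p.1, e, p; split=> //; left.
Qed.

Lemma digroup_inverse_vdash :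
  g_digroup -> forall a x y b,
  digroup_inverse a x -> digroup_inverse a y -> x ⊢ b = y ⊢ b.
Proof.
move=> [[vA _ _ _ vl] _ _] a x y b.
have IJ e p e' p' : bar_unit e -> inverse_pair e a p ->
    bar_unit e' -> inverse_pair e' a p' -> p.1 ⊢ b = p'.2 ⊢ b.
  move=> ue [pI _] ue' [_ pJ].
  by rewrite -{1}(ue' b).1 pJ !vA [p.1 ⊢ a ⊢ _]vl pI (ue _).1.
move=> [e [p [ue ip xp]]] [e' [p' [ue' ip' yp]]].
have -> : x ⊢ b = p.2 ⊢ b by case: xp => -> //; apply: (IJ e p e p).
have -> : y ⊢ b = p'.2 ⊢ b by case: yp => -> //; apply: (IJ e' p' e' p').
by rewrite -(IJ e p e p) // (IJ e p e' p').
Qed.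

Lemma digroup_inverse_dashv :
  g_digroup -> forall a x y b,
  digroup_inverse a x -> digroup_inverse a y -> b ⊣ x = b ⊣ y.
Proof.
move=> [[_ dA _ dr _] _ _] a x y b.
have IJ e p e' p' : bar_unit e -> inverse_pair e a p ->
    bar_unit e' -> inverse_pair e' a p' -> b ⊣ p.1 = b ⊣ p'.2.
  move=> ue [pI _] ue' [_ pJ].
  rewrite [b ⊣ p.1](ue' _).2 pJ dr.
  by rewrite -!dA [p.1 ⊣ _]dA pI -dr (ue _).1.
move=> [e [p [ue ip xp]]] [e' [p' [ue' ip' yp]]].
have -> : b ⊣ x = b ⊣ p.2 by case: xp => -> //; apply: (IJ e p e p).
have -> : b ⊣ y = b ⊣ p'.2 by case: yp => -> //; apply: (IJ e' p' e' p').
by rewrite -(IJ e p e p) // (IJ e p e' p').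
Qed.

Record right_group : Prop := {
  circA : associative circ;
  right_group_solve : forall a b, exists! x, a ∘ x = b
}.

Record di_skew_brace : Prop := {
  di_skew_brace_g_digroup : g_digroup;
  di_skew_brace_right_group : right_group;
  circ_vdashr : forall a b c a', digroup_inverse a a' ->
    a ∘ (b ⊢ c) = a ∘ b ⊢ (a' ⊢ a ∘ c);
  circ_dashvr : forall a b c a', digroup_inverse a a' ->
    a ∘ (b ⊣ c) = (a ∘ b ⊣ a') ⊣ a ∘ c;
  circ_vdash_dashvl : forall a b c, (a ⊢ b) ∘ c = (a ⊣ b) ∘ c
}.

End DiSkewBraces.

(* Main.v *)
Require Import Defs.
From mathcomp Require Import all_boot.

Local Open Scope group_scope.

(** Writing [a ⊢ b = f a * b], [a ⊣ b = a * g b] and [a ∘ b = h a * b], each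
    operation multiplies one argument, left untouched, by a group element that
    depends only on the other one.  Hence every axiom of a di-skew brace is an
    equation between words of [D] having that untouched argument as a common
    factor, which can be cancelled.

    The axioms that do not mix [∘] with [⊢] and [⊣] reduce in this way to the
    averaging identities and always hold ([g_digroup_averaging],
    [right_group_left_averaging]).  For the mixed ones, the point is that
    although a digroup inverse [a'] of [a] depends on a bar-unit, both [f] and
    [g] send it to the inverse of the image of [a] in the group [D]
    ([averaging_digroup_inverse]): bar-units lie in the common kernel of [f]
    and [g], and the averaging identities turn the equations defining [a'] into
    [f a' * f a = 1] or [f a * f a' = 1], and likewise for [g].  The mixed
    axioms then read
    - [h a * f b * c = f (h a * b) * (f a)^-1 * h a * c],
    - [h a * b * g c = h a * b * (g a)^-1 * g (h a * c)],
    - [h (f a * b) * c = h (a * g b) * c],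

    and cancelling the common factors leaves exactly the three identities. *)

Section AveragingDigroup.
Variables (D : groupType) (f g : D -> D).

Local Notation vdash := (fun a b : D => f a * b).
Local Notation dashv := (fun a b : D => a * g b).

(** Each disemigroup axiom is an averaging identity multiplied by the argument
    left untouched. *)
Lemma disemigroup_averaging : averaging_pair f g -> disemigroup vdash dashv.
Proof.
move=> [fl fr gr gl]; split=> a b c /=.
- by rewrite mulgA fl.
- by rewrite -mulgA gr.
- by rewrite mulgA.
- by rewrite gl.
- by rewrite fr.
Qed.

Lemma bar_unit_averaging e : bar_unit vdash dashv e <-> f e = 1 /\ g e = 1.
Proof.
split=> [ue|[fe ge] a]; last by rewrite fe ge mul1g mulg1.
have /= [fe ge] := ue 1.
by rewrite mulg1 in fe; rewrite mul1g in ge.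
Qed.

(** Compatibility provides the bar-unit; inverse pairs exist and are unique
    because the equations [x * g a = e] and [f a * y = e] are solved in the
    group [D]. *)
Lemma g_digroup_averaging :
  averaging_pair f g -> compatible f g -> g_digroup vdash dashv.
Proof.
move=> avg [e kere]; split; first exact: disemigroup_averaging.
  by exists e; apply/bar_unit_averaging.
move=> a e' _; exists (e' * (g a)^-1, (f a)^-1 * e'); split.
  by split; rewrite /= ?mulgVK ?mulVKg.
by move=> [x y] [/= <- xy]; rewrite mulgK xy mulKg.
Qed.

Lemma averaging_digroup_inverse a a' :
  averaging_pair f g -> digroup_inverse vdash dashv a a' ->
  f a' = (f a)^-1 /\ g a' = (g a)^-1.
Proof.
move=> [fl fr gr gl] [e [[x y] [/bar_unit_averaging[fe ge] [/= xa ay] a'E]]].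
case: a'E => ->.
- split.
  + by apply: (mulIg (f a)); rewrite mulVg fl fr xa.
  + by apply: (mulIg (g a)); rewrite mulVg gr xa.
- split.
  + by apply: (mulgI (f a)); rewrite mulgV fl -ay.
  + by apply: (mulgI (g a)); rewrite mulgV gr gl -ay.
Qed.

End AveragingDigroup.

Lemma right_group_left_averaging (D : groupType) (h : D -> D) :
  left_averaging_operator h -> right_group (fun a b : D => h a * b).
Proof.
move=> h_avg; split=> [a b c|a b] /=; first by rewrite mulgA h_avg.
by exists ((h a)^-1 * b); split=> [|x <-]; rewrite ?mulVKg ?mulKg.
Qed.

Theorem proposition3p9 (D : groupType) (f g : D -> D)
    (fg_averaging : averaging_pair f g) (fg_compatible : compatible f g)
    (h : D -> D) (h_averaging : left_averaging_operator h) :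
  di_skew_brace (fun a b : D => f a * b) (fun a b : D => a * g b)
                (fun a b : D => h a * b)
  <->
  [/\ forall a b : D, h a * f b = f (h a * b) * (f a)^-1 * h a,
      forall a b : D, g a * g b = g (h a * b)
    & forall a b : D, h (f a * b) = h (a * g b)].
Proof.
have dg := g_digroup_averaging D f g fg_averaging fg_compatible.
have invE a a' := averaging_digroup_inverse D f g a a' fg_averaging.
split=> [[_ _ circ_vdash circ_dashv circ_l]|[hf hg hfg]].
- split=> a b.
  + have [a' a'P] := digroup_inverse_exists dg a.
    have := circ_vdash a b 1 a' a'P.
    by rewrite /= (invE _ _ a'P).1 !mulg1 mulgA.
  + have [a' a'P] := digroup_inverse_exists dg a.
    have := circ_dashv a 1 b a' a'P.
    rewrite /= (invE _ _ a'P).2 mul1g mulg1 -mulgA => /mulgI ->.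
    by rewrite mulVKg.
  + exact: mulIg (circ_l a b 1).
- split=> // [|a b c a' /invE[fa' _]|a b c a' /invE[_ ga']|a b c] /=.
  + exact: right_group_left_averaging.
  + by rewrite fa' mulgA hf !mulgA.
  + by rewrite ga' -hg !mulgA mulgVK.
  + by rewrite hfg.
Qed.
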